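(* Let $m\ge 1$ and $n\ge 2$ be integers. Then $$b(K_m\boxtimes P_n)=\begin{cases}\lceil \frac{m}{2}\rceil, & \text{if } n\equiv 0 \pmod 3;\\ m, & \text{if } n\equiv 2 \pmod 3;\\ \lceil \frac{3m}{2}\rceil, & \text{if } n\equiv 1 \pmod 3.\end{cases}$$
   Context: All graphs are finite, undirected and simple. $K_m$ is the complete graph on $m$ vertices and $P_n$ is the path on $n$ vertices. The strong product $G\boxtimes H$ has vertex set $V(G)\times V(H)$, and $(g_1,h_1)$, $(g_2,h_2)$ are adjacent iff either $g_1=g_2$ and $h_1h_2\in E(H)$, or $g_1g_2\in E(G)$ and $h_1=h_2$, or $g_1g_2\in E(G)$ and $h_1h_2\in E(H)$. A dominating set of $G$ is a set $D\subseteq V(G)$ such that every vertex of $G$ is in $D$ or adjacent to a vertex of $D$; $\gamma(G)$ is the minimum cardinality of a dominating set. For a graph $G$ with at least one edge, the bondage number $b(G)$ is the minimum cardinality of a set $S\subseteq E(G)$ such that $\gamma(G-S)>\gamma(G)$, where $G-S$ is obtained by deleting the edges in $S$ (keeping all vertices). *)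

(* Defs.v *)
From HB Require Import structures.
From mathcomp Require Import all_boot.
Set Implicit Arguments.
Unset Strict Implicit.
Unset Printing Implicit Defensive.

(* The vertex set is a parameter, so that deleting edges stays in the same
   type of graphs.                                                          *)
Record sgraph (T : finType) := SGraph {
  adj :> rel T;
  adj_sym : symmetric adj;
  adj_irr : irreflexive adj
}.

Section Graphs.
Variable T : finType.
Implicit Types (G : sgraph T) (D : {set T}) (S : {set {set T}}).

Definition edges G : {set {set T}} :=
  [set e | [exists x, exists y, G x y && (e == [set x; y])]].

Definition del_rel G S : rel T :=
  fun x y => G x y && ([set x; y] \notin S).

Fact del_sym G S : symmetric (del_rel G S).
Proof. by move=> x y; rewrite /del_rel adj_sym setUC. Qed.

Fact del_irr G S : irreflexive (del_rel G S).
Proof. by move=> x; rewrite /del_rel adj_irr. Qed.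

Definition del_edges G S : sgraph T := SGraph (del_sym G S) (del_irr G S).

Definition dominating G D : bool :=
  [forall x, (x \in D) || [exists y in D, G x y]].

Definition domination_number G : nat :=
  #|[arg min_(D < [set: T] | dominating G D) #|D|]|.

Definition bondage_set G S : bool :=
  (S \subset edges G) &&
  (domination_number G < domination_number (del_edges G S)).

(* The default edges G is a bondage set as soon as G has an edge; for an
   edgeless graph there is no bondage set and the value is the junk 0.      *)
Definition bondage_number G : nat :=
  #|[arg min_(S < edges G | bondage_set G S) #|S|]|.

End Graphs.

Definition strong_rel (T U : finType) (G : sgraph T) (H : sgraph U) :
    rel (T * U) := fun p q =>
  [|| (p.1 == q.1) && H p.2 q.2,
      G p.1 q.1 && (p.2 == q.2)
    | G p.1 q.1 && H p.2 q.2].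

Fact strong_sym (T U : finType) (G : sgraph T) (H : sgraph U) :
  symmetric (strong_rel G H).
Proof.
move=> p q; rewrite /strong_rel (eq_sym p.1) (eq_sym p.2).
by rewrite (adj_sym G p.1) (adj_sym H p.2).
Qed.

Fact strong_irr (T U : finType) (G : sgraph T) (H : sgraph U) :
  irreflexive (strong_rel G H).
Proof. by move=> p; rewrite /strong_rel !adj_irr andbF. Qed.

Definition strong_product (T U : finType) (G : sgraph T) (H : sgraph U) :
  sgraph (T * U)%type := SGraph (strong_sym G H) (strong_irr G H).

Definition complete_rel m : rel 'I_m := fun i j => i != j.

Fact complete_sym m : symmetric (@complete_rel m).
Proof. by move=> i j; rewrite /complete_rel eq_sym. Qed.

Fact complete_irr m : irreflexive (@complete_rel m).
Proof. by move=> i; rewrite /complete_rel eqxx. Qed.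

Definition complete_graph m : sgraph 'I_m :=
  SGraph (@complete_sym m) (@complete_irr m).

Definition path_rel n : rel 'I_n := fun i j => (i.+1 == j) || (j.+1 == i).

Fact path_sym n : symmetric (@path_rel n).
Proof. by move=> i j; rewrite /path_rel orbC. Qed.

Fact path_irr n : irreflexive (@path_rel n).
Proof. by move=> i; rewrite /path_rel eqn_leq ltnn. Qed.

Definition path_graph n : sgraph 'I_n := SGraph (@path_sym n) (@path_irr n).

(* Main.v *)
Require Import Defs.
From HB Require Import structures.
From mathcomp Require Import all_boot.
From mathcomp Require Import zify.
Set Implicit Arguments.
Unset Strict Implicit.
Unset Printing Implicit Defensive.

(** The vertices of [K_m] x [P_n] form [n] layers of size [m], and two distinct
    vertices are adjacent exactly when their layers are equal or consecutive.
    One vertex per layer of a dominating set of the path dominates the product,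
    and layers three apart need distinct dominators, so the domination number
    is the ceiling [K] of [n / 3].

    Lower bound. After the deletion of [S], a vertex touching no edge of [S]
    dominates as before. A layer without such a free vertex is bad, and [b] bad
    layers force [m * b <= 2 * #|S|] ([bad_layers_le]). It remains to cover the
    path by [K] good layers. If [n = 3k] the covering is unique, but for
    [2 * #|S| < m] no layer is bad. If [n = 3k + 2] there are two disjoint
    coverings, and for [#|S| < m] at most one layer is bad. If [n = 3k + 1] and
    [2 * #|S| < 3 * m], at most two layers are bad; the coverings
    ([layout_domination1]) avoid any two layers except the two first or the two
    last ones. In that exceptional case every layer but the extreme one is
    covered by [k] good layers, and some vertex still dominates the extreme
    layer, for otherwise the edges deleted there would number at least
    [3m / 2] ([end_layer_count]).

    Upper bound. Two sets of deletions are used: a perfect matching between the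
    first two layers ([m] edges), and edges reaching every vertex of one layer,
    paired up as far as possible (half of [m], rounded up). The latter in layer
    1 suits [n = 3k], the former [n = 3k + 2], and the former with the latter in
    layer 2 suits [n = 3k + 1]. Starting from a dominator of the first layer,
    a vertex that lost an edge leaves its former neighbour to a second
    dominator close by ([other_dominator]); the remaining layers, three apart,
    still need one vertex each ([packing]), which makes more than [K]. *)

(** * Domination and bondage numbers of arbitrary graphs *)

Section General.
Variable T : finType.
Implicit Types (G H : sgraph T) (D : {set T}) (S : {set {set T}}).

Lemma dominating_setT G : dominating G [set: T].
Proof. by apply/forallP => x; rewrite inE. Qed.

Lemma domination_number_le G D : dominating G D -> domination_number G <= #|D|.
Proof.
rewrite /domination_number => domD.
by case: arg_minnP => [|D' _]; [exact: dominating_setT | exact].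
Qed.

Lemma domination_number_gt G k :
  (forall D, dominating G D -> #|D| <= k -> False) -> k < domination_number G.
Proof.
rewrite /domination_number => noD.
case: arg_minnP => [|D domD _]; first exact: dominating_setT.
by rewrite ltnNge; apply/negP; exact: noD.
Qed.

Lemma dominatingP G D :
  reflect (forall x, exists2 y, y \in D & x = y \/ G x y) (dominating G D).
Proof.
apply: (iffP forallP) => [domD x | domD x].
  case/orP: (domD x) => [xD | /existsP[y /andP[yD xy]]]; first by exists x; auto.
  by exists y; auto.
have [y yD [->|xy]] := domD x; first by rewrite yD.
by apply/orP; right; apply/existsP; exists y; rewrite yD.
Qed.

Lemma domination_number_sub G H :
  (forall x y, H x y -> G x y) -> domination_number G <= domination_number H.
Proof.
move=> sHG; rewrite {2}/domination_number.
case: arg_minnP => [|D /dominatingP domD _]; first exact: dominating_setT.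
apply/domination_number_le/dominatingP => x.
by have [y yD [->|/sHG xy]] := domD x; exists y; auto.
Qed.

Lemma domination_number_del G S :
  domination_number G <= domination_number (del_edges G S).
Proof. by apply: domination_number_sub => x y /andP[]. Qed.

(** Deleting further edges cannot lower the domination number, so the default
    value of the minimum defining the bondage number is itself a bondage set
    as soon as one exists. *)
Lemma bondage_set_edges G S : bondage_set G S -> bondage_set G (edges G).
Proof.
case/andP=> sSE ltS; rewrite /bondage_set subxx /=.
apply: leq_trans ltS _; apply: domination_number_sub => x y /andP[Gxy nE].
by rewrite /= /del_rel Gxy; apply: contra nE; apply/subsetP.
Qed.

Lemma bondage_numberE G S b :
    bondage_set G S -> #|S| <= b ->
    (forall S', S' \subset edges G -> #|S'| < b ->
      domination_number (del_edges G S') <= domination_number G) ->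
  bondage_number G = b.
Proof.
move=> bS leSb few; rewrite /bondage_number.
case: arg_minnP => [|S' /andP[sS'E ltS'] minS'].
  exact: bondage_set_edges bS.
apply/eqP; rewrite eqn_leq (leq_trans (minS' _ bS) leSb) /=.
by rewrite leqNgt; apply/negP => /(few _ sS'E); rewrite leqNgt ltS'.
Qed.

(** Double counting of the incidences between [A] and [P]. *)
Lemma card_le_mul_cover (A : {set T}) (P : {set {set T}}) c :
    (forall v, v \in A -> exists2 s, s \in P & v \in s) ->
    (forall s, s \in P -> #|s :&: A| <= c) ->
  #|A| <= c * #|P|.
Proof.
move=> covA leC.
have sA : A \subset \bigcup_(s in P) (s :&: A).
  apply/subsetP => v vA; have [s sP vs] := covA v vA.
  by apply/bigcupP; exists s; rewrite // inE vs.
apply: leq_trans (subset_leq_card sA) _.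
apply: (@leq_trans (\sum_(s in P) #|s :&: A|)); last first.
  by rewrite mulnC -sum_nat_const; apply: leq_sum.
elim/big_rec2: _ => [|s k B _ le]; first by rewrite cards0.
by apply: leq_trans (leq_card_setU _ _) _; rewrite leq_add2l.
Qed.

Lemma edges_card G e : e \in edges G -> #|e| <= 2.
Proof.
rewrite inE => /existsP[x /existsP[y /andP[_ /eqP->]]].
by rewrite cards2; case: (_ != _).
Qed.

Lemma edges_mem G x y : G x y -> [set x; y] \in edges G.
Proof.
by move=> xy; rewrite inE; apply/existsP; exists x; apply/existsP; exists y;
   rewrite xy /=.
Qed.

End General.

(** * The layers of the product *)

Definition near (i j : nat) := (i <= j.+1) && (j <= i.+1).

Section Layers.
Variables m n : nat.
Hypothesis m_gt0 : 0 < m.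

Local Notation V := ('I_m * 'I_n)%type.
Local Notation G := (strong_product (complete_graph m) (path_graph n)).

Implicit Types (S : {set {set V}}) (D : {set V}) (x y v d : V).

Lemma product_adjE x y : G x y = (x != y) && near x.2 y.2.
Proof.
case: x y => [i a] [j b]; rewrite /= /strong_rel /= /complete_rel /path_rel /near.
rewrite xpair_eqE -!val_eqE /=; lia.
Qed.

Let i0 : 'I_m := Ordinal m_gt0.

(** The layers [a, a+3, a+6, ...] have disjoint closed neighbourhoods, so a
    dominating set spends one vertex on each of them; these vertices are all
    above the ones listed in [s]. *)
Lemma packing (H : sgraph V) D (s : seq V) a t :
    (forall x y, H x y -> near x.2 y.2) -> dominating H D ->
    uniq s -> (forall v, v \in s -> v \in D /\ v.2.+1 < a) ->
    (forall j, j < t -> a + 3 * j < n) ->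
  size s + t <= #|D|.
Proof.
move=> Hnear /dominatingP domD us sP lt_n.
have rep (j : 'I_t) : {y | (y \in D) && near (a + 3 * j) y.2}.
  apply: sigW; have [y yD xy] := domD (i0, Ordinal (lt_n _ (ltn_ord j))).
  exists y; rewrite yD /=; case: xy => [<-|/Hnear //]; rewrite /near /=; lia.
pose f j := sval (rep j).
have fP j : (f j \in D) /\ near (a + 3 * j) (f j).2 by apply/andP/(svalP (rep j)).
have injf : injective f.
  move=> j k ejk; have [_] := fP j; have [_] := fP k.
  by rewrite ejk /near => nk nj; apply: val_inj => /=; lia.
have us' : uniq (s ++ [seq f j | j <- enum 'I_t]).
  rewrite cat_uniq us map_inj_uniq // enum_uniq andbT /=.
  apply/hasPn => _ /mapP[j _ ->]; apply/negP => /sP[_].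
  have [_ /andP[le _]] := fP j.
  by rewrite ltnNge (leq_trans (leq_addr _ _) le).
have -> : size s + t = size (s ++ [seq f j | j <- enum 'I_t]).
  by rewrite size_cat size_map size_enum_ord.
rewrite cardE; apply: uniq_leq_size => // v; rewrite mem_cat mem_enum.
by case/orP => [/sP[] // | /mapP[j _ ->]]; have [] := fP j.
Qed.

Lemma del_near S x y : del_edges G S x y -> near x.2 y.2.
Proof. by case/andP; rewrite product_adjE => /andP[]. Qed.

Lemma product_domination_ge : (n + 2) %/ 3 <= domination_number G.
Proof.
have Gnear x y : G x y -> near x.2 y.2 by rewrite product_adjE => /andP[].
have : (n + 2) %/ 3 - 1 < domination_number G \/ (n + 2) %/ 3 = 0; last lia.
have [->|K0] := eqVneq ((n + 2) %/ 3) 0; [by right | left].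
apply: domination_number_gt => D domD leD.
suff : 0 + (n + 2) %/ 3 <= #|D| by lia.
by apply: (packing (s := [::]) (a := 0) Gnear domD) => // j; lia.
Qed.

(** * Few deletions do not raise the domination number *)

(** A vertex touching no deleted edge still dominates its own layer and the
    adjacent ones. *)
Definition free S v := [forall s in S, v \notin s].

Definition good S (i : nat) := [exists v : V, (v.2 == i :> nat) && free S v].

Lemma free_dominates S x v : free S v -> near x.2 v.2 -> x = v \/ del_edges G S x v.
Proof.
move=> /forall_inP fv nxv; have [->|nexv] := eqVneq x v; [by left | right].
rewrite /= /del_rel product_adjE nexv nxv /=.
by apply/negP => /fv; rewrite !inE eqxx orbT.
Qed.

Lemma not_dominated S x v :
  near x.2 v.2 -> ~ (x = v \/ del_edges G S x v) -> [set x; v] \in S /\ x != v.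
Proof.
move=> nxv nd; have nexv: x != v by apply/eqP => e; case: nd; left.
split=> //; apply/negPn/negP => nS; case: nd; right.
by rewrite /= /del_rel product_adjE nexv nxv.
Qed.

Definition free_vertex S v0 i : V :=
  odflt v0 [pick v : V | (v.2 == i :> nat) && free S v].

Lemma free_vertexP S v0 i :
  good S i -> nat_of_ord (free_vertex S v0 i).2 = i /\ free S (free_vertex S v0 i).
Proof.
rewrite /good /free_vertex => /existsP gi; case: pickP => [v /andP[/eqP]//|no].
by case: gi => v; rewrite no.
Qed.

(** Free vertices of the layers [p j], completed by [D0] where these layers
    do not reach. *)
Lemma layout_domination S (D0 : {set V}) p t :
    0 < n ->
    (forall j, j < t -> good S (p j)) ->
    (forall x, (exists2 j, j < t & near x.2 (p j)) \/
       (exists2 v, v \in D0 & x = v \/ del_edges G S x v)) ->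
  domination_number (del_edges G S) <= #|D0| + t.
Proof.
move=> n_gt0 gp cov; pose v0 : V := (i0, Ordinal n_gt0).
pose D := D0 :|: [set free_vertex S v0 (p j) | j : 'I_t].
apply: (@leq_trans #|D|); last first.
  apply: leq_trans (leq_card_setU _ _) _; rewrite leq_add2l.
  by apply: leq_trans (leq_imset_card _ _) _; rewrite card_ord.
apply/domination_number_le/dominatingP => x.
case: (cov x) => [[j ltj nj] | [v vD0 xv]]; last by exists v; rewrite // inE vD0.
exists (free_vertex S v0 (p j)).
  by rewrite inE; apply/orP; right; apply/imsetP; exists (Ordinal ltj).
by have [lv fv] := free_vertexP v0 (gp j ltj); apply: free_dominates; rewrite ?lv.
Qed.

Lemma layout_domination0 S p t :
    0 < n -> (forall j, j < t -> good S (p j)) ->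
    (forall i, i < n -> exists2 j, j < t & near i (p j)) ->
  domination_number (del_edges G S) <= t.
Proof.
move=> n_gt0 gp cov; rewrite -[t]add0n -(cards0 V).
by apply: layout_domination gp _ => // x; left; apply: cov.
Qed.

Lemma card_layers (A : {set 'I_n}) : #|[set v : V | v.2 \in A]| = m * #|A|.
Proof.
rewrite -[m in RHS]card_ord -cardsT -cardsX; congr #|pred_of_set _|.
by apply/setP => v; rewrite !inE.
Qed.

(** Every vertex of a bad layer is an endpoint of a deleted edge, and an edge
    has two endpoints. *)
Lemma bad_layers_le S (s : seq nat) :
    S \subset edges G -> uniq s ->
    (forall i, i \in s -> i < n /\ ~~ good S i) ->
  m * size s <= 2 * #|S|.
Proof.
move=> sSE us bad; pose B := [set i : 'I_n | ~~ good S i].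
apply: (@leq_trans (m * #|B|)).
  rewrite leq_mul2l; apply/orP; right.
  rewrite cardE -(size_map val); apply: uniq_leq_size => // i /bad[lti bi].
  by apply/mapP; exists (Ordinal lti); rewrite // mem_enum inE.
rewrite -card_layers; apply: card_le_mul_cover => [v | e eS].
  rewrite !inE => /existsPn/(_ v); rewrite eqxx /= negb_forall_in.
  by case/exists_inP => e eS; rewrite negbK => ve; exists e.
apply: leq_trans (edges_card (subsetP sSE _ eS)).
by apply/subset_leq_card/subsetIl.
Qed.

(** If no vertex of the layers [e], [e'] dominates layer [e], then each vertex
    of layer [e] needs a deleted edge inside that layer, which
    makes [m / 2] edges, and each vertex of layer [e'] one between the two
    layers, which makes [m] others. *)
Lemma end_layer_count S (e e' : 'I_n) :
    S \subset edges G -> e != e' -> near e e' ->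
    (forall v, v.2 \in [:: e; e'] ->
       exists2 x : V, x.2 = e & ~ (x = v \/ del_edges G S x v)) ->
  3 * m <= 2 * #|S|.
Proof.
move=> sSE nee' near_ee' fail.
have lost v : v.2 \in [:: e; e'] -> exists2 x : V, x.2 = e & [set x; v] \in S.
  move=> ve; have [x xe nd] := fail v ve; exists x => //.
  apply: (proj1 (not_dominated _ nd)).
  move: ve; rewrite xe !inE => /orP[]/eqP-> //; rewrite /near; lia.
pose L i := [set v : V | v.2 \in [set i]].
have cardL i : #|L i| = m by rewrite card_layers cards1 muln1.
pose S0 := [set s in S | s \subset L e].
pose S1 := [set s in S | (s :&: L e != set0) && (s :&: L e' != set0)].
have le0 : m <= 2 * #|S0|.
  rewrite -{1}(cardL e); apply: card_le_mul_cover => [v | s].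
    rewrite !inE => /eqP ve; have [|x xe xvS] := lost v; first by rewrite ve !inE eqxx.
    exists [set x; v]; last by rewrite !inE eqxx orbT.
    by rewrite inE xvS; apply/subsetP => y; rewrite !inE => /orP[]/eqP->; apply/eqP.
  rewrite inE => /andP[/(subsetP sSE)/edges_card le2 _].
  by apply: leq_trans le2; apply/subset_leq_card/subsetIl.
have le1 : m <= 1 * #|S1|.
  rewrite -{1}(cardL e'); apply: card_le_mul_cover => [v | s].
    rewrite !inE => /eqP ve; have [|x xe xvS] := lost v.
      by rewrite ve !inE eqxx orbT.
    exists [set x; v]; last by rewrite !inE eqxx orbT.
    rewrite inE xvS /=; apply/andP; split; apply/set0Pn.
      by exists x; rewrite !inE xe !eqxx.
    by exists v; rewrite !inE ve !eqxx orbT.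
  rewrite inE => /and3P[/(subsetP sSE)/edges_card le2 n0 _].
  have dis : [disjoint s :&: L e & s :&: L e'].
    rewrite disjoint_subset; apply/subsetP => y; rewrite !inE => /andP[_ /eqP->].
    by rewrite (negPf nee') andbF.
  have : #|(s :&: L e) :|: (s :&: L e')| <= #|s|.
    by apply/subset_leq_card; rewrite subUset !subsetIl.
  rewrite cardsU (disjoint_setI0 dis) cards0 subn0 => le.
  have arith a b c : 0 < a -> a + b <= c -> c <= 2 -> b <= 1 by lia.
  by apply: arith le le2; rewrite card_gt0.
have : #|S0 :|: S1| <= #|S|.
  apply/subset_leq_card/subsetP => s; rewrite !inE.
  by case/orP => /andP[].
have dis : [disjoint S0 & S1].
  rewrite disjoint_subset; apply/subsetP => s; rewrite !inE => /andP[_ sL].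
  rewrite !negb_and; apply/orP; right; apply/orP; right; rewrite negbK.
  apply/eqP/setP => y; rewrite !inE; apply/negP => /andP[/(subsetP sL)].
  by rewrite !inE => /eqP->; rewrite (negPf nee').
rewrite cardsU (disjoint_setI0 dis) cards0 subn0.
lia.
Qed.

Lemma end_dominator S (e e' : 'I_n) :
    S \subset edges G -> e != e' -> near e e' -> 2 * #|S| < 3 * m ->
  exists v, forall x, x.2 = e -> x = v \/ del_edges G S x v.
Proof.
move=> sSE nee' near_ee' few.
pose dominates v := [forall x : V, (x.2 == e) ==> ((x == v) || del_edges G S x v)].
case: (pickP [pred v : V | dominates v]) => [v /forallP dv | none].
  exists v => x /eqP xe; move: (dv x); rewrite xe /=.
  by case/orP => [/eqP|]; [left | right].
suff : 3 * m <= 2 * #|S| by rewrite leqNgt few.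
apply: (end_layer_count sSE nee' near_ee') => v _.
move: (none v) => /= /negbT /forallPn[x]; rewrite negb_imply negb_or.
case/and3P=> /eqP xe nxv nd; exists x => // -[e1|]; last exact/negP.
by rewrite e1 eqxx in nxv.
Qed.

Lemma few_deletions_mod0 S k : n = 3 * k -> 0 < n ->
    S \subset edges G -> 2 * #|S| < m ->
  domination_number (del_edges G S) <= k.
Proof.
move=> nE n_gt0 sSE few.
have gd i : i < n -> good S i.
  move=> lti; case: (boolP (good S i)) => // bi; exfalso.
  suff : m * 1 <= 2 * #|S| by lia.
  by apply: (@bad_layers_le S [:: i]) => // i'; rewrite inE => /eqP->.
apply: (@layout_domination0 S (fun j => 3 * j + 1)) => // [j ltj|i lti].
  by apply: gd; lia.
by exists (i %/ 3); rewrite /near; lia.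
Qed.

(** The layers [3j] and the layers [3j + 1] are two disjoint coverings. *)
Lemma few_deletions_mod2 S k : n = 3 * k + 2 ->
    S \subset edges G -> #|S| < m ->
  domination_number (del_edges G S) <= k.+1.
Proof.
move=> nE sSE few.
have n_gt0 : 0 < n by lia.
case: (boolP [forall j : 'I_k.+1, good S (3 * j)]) => [/forallP g0 | /forallPn[j bj]].
  apply: (@layout_domination0 S (fun j => 3 * j)) => // [j ltj|i lti].
    exact: (g0 (Ordinal ltj)).
  by exists ((i + 1) %/ 3); rewrite /near; lia.
apply: (@layout_domination0 S (fun j => 3 * j + 1)) => // [j' ltj'|i lti]; last first.
  by exists (i %/ 3); rewrite /near; lia.
case: (boolP (good S (3 * j' + 1))) => // bj'; exfalso.
suff : m * 2 <= 2 * #|S| by lia.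
apply: (@bad_layers_le S [:: 3 * j; 3 * j' + 1]) => // [|i].
  by rewrite /= inE andbT; lia.
by rewrite !inE => /orP[]/eqP->; split=> //; have := ltn_ord j; lia.
Qed.

(** A covering of the [3 * k + 1] layers by [k.+1] of them picks one layer in
    each block [3j-1, 3j, 3j+1], with an offset that may only decrease as [j]
    grows: 1 below [a], 0 between [a] and [b], -1 from [b] on. *)
Lemma layout_domination1 S k a b : n = 3 * k + 1 ->
    a <= k -> 0 < b -> a <= b -> b <= k.+1 ->
    (forall j, j < a -> good S (3 * j + 1)) ->
    (forall j, a <= j < b -> good S (3 * j)) ->
    (forall j, b <= j <= k -> good S (3 * j - 1)) ->
  domination_number (del_edges G S) <= k.+1.
Proof.
move=> nE lak b_gt0 lab lbk g1 g0 gN.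
pose p j := if j < a then 3 * j + 1 else if j < b then 3 * j else 3 * j - 1.
apply: (@layout_domination0 S p) => [|j ltj|i lti]; first lia.
  rewrite /p; case: ltnP => aj; first exact: g1.
  by case: ltnP => bj; [apply: g0 | apply: gN]; lia.
have [j ij] : exists j, 3 * j <= i + 1 < 3 * j + 3 by exists ((i + 1) %/ 3); lia.
have [nj|far] := boolP (near i (p j)); first by exists j => //; lia.
have [ltja|leaj] := ltnP j a.
  by exists (j - 1); move: far; rewrite /p /near ltja; case: ltnP => h; lia.
by exists j.+1; move: far; rewrite /p /near;
  do 2![case: ltnP => ?]; do 2?[case: ltnP => ?]; lia.
Qed.

(** With at most two bad layers, the offset can be chosen to avoid them. If two
    bad layers are multiples of 3, one steps over both: offset 1 up to the
    first, -1 from the second on. If only [3j] is one, the offset 1 up to [j]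
    then 0, or 0 then -1 from [j] on, succeeds unless the second bad layer
    obstructs both; that happens only for [3j] an end layer and the second one
    its neighbour. *)
Lemma few_deletions_mod1 S k : 0 < k -> n = 3 * k + 1 ->
    S \subset edges G -> 2 * #|S| < 3 * m ->
  domination_number (del_edges G S) <= k.+1.
Proof.
move=> k_gt0 nE sSE few.
have n_gt0 : 0 < n by lia.
have third i1 i2 i3 : i1 < n -> i2 < n -> i3 < n -> ~~ good S i1 -> ~~ good S i2 ->
    i1 != i2 -> i1 != i3 -> i2 != i3 -> good S i3.
  move=> l1 l2 l3 b1 b2 d12 d13 d23; case: (boolP (good S i3)) => // b3; exfalso.
  suff : m * 3 <= 2 * #|S| by lia.
  apply: (@bad_layers_le S [:: i1; i2; i3]) => // [|i].
    by rewrite /= !inE; lia.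
  by rewrite !inE => /or3P[]/eqP->.
case: (boolP [forall j : 'I_k.+1, good S (3 * j)]);
  last move=> /forallPn[[j ltj] /= bj].
  move=> /forallP g0.
  apply: (@layout_domination1 S k 0 k.+1) => // i ik; last lia.
  have lti : i < k.+1 by lia.
  exact: (g0 (Ordinal lti)).
have two j1 j2 : j1 < j2 -> j2 <= k -> ~~ good S (3 * j1) -> ~~ good S (3 * j2) ->
    domination_number (del_edges G S) <= k.+1.
  move=> l12 l2 b1 b2.
  apply: (@layout_domination1 S k j1.+1 j2) => // [|||i ik|i ik|i ik]; try lia;
  by apply: (@third (3 * j1) (3 * j2)) => //; lia.
case: (boolP [exists i : 'I_k.+1, (i != j :> nat) && ~~ good S (3 * i)]).
  case/existsP => -[i lti] /= /andP[nij bi].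
  by have [ltij|geij] := ltnP i j; [apply: (two i j) | apply: (two j i)] => //; lia.
move=> /existsPn only.
have g0 i : i <= k -> i != j -> good S (3 * i).
  move=> leik nij; have lti : i < k.+1 by lia.
  by have := only (Ordinal lti); rewrite /= nij negbK.
case: (boolP ((j < k) && [forall i : 'I_j.+1, good S (3 * i + 1)])).
  case/andP=> ltjk /forallP g1.
  apply: (@layout_domination1 S k j.+1 k.+1) => // i ik; try lia.
  - exact: (g1 (Ordinal ik)).
  - by apply: g0; lia.
rewrite negb_and => fail1.
case: (boolP ((0 < j) && [forall i : 'I_k.+1, (j <= i) ==> good S (3 * i - 1)])).
  case/andP=> j_gt0 /forallP gN.
  apply: (@layout_domination1 S k 0 j) => // [|i ik|i ik]; first lia.
    by apply: g0; lia.
  have lti : i < k.+1 by lia.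
  by apply: (implyP (gN (Ordinal lti))); case/andP: ik.
rewrite negb_and => fail2.
have bad1 : j < k -> exists2 i, i <= j & ~~ good S (3 * i + 1).
  by move=> ltjk; move: fail1; rewrite ltjk => /forallPn[[i lti] bi]; exists i.
have badN : 0 < j -> exists2 i, j <= i <= k & ~~ good S (3 * i - 1).
  move=> j_gt0; move: fail2; rewrite j_gt0 => /forallPn[[i lti]] /=.
  by rewrite negb_imply => /andP[leji bi]; exists i; rewrite ?leji.
(* Layers 0 and 1 are bad: one vertex for layer 0, layers 2, 5, ... above. *)
have [j0|j_gt0] := posnP j.
  have lt1n : 1 < n by lia.
  have [|i li bi] := bad1; first lia.
  have {li}i0E : i = 0 by lia.
  subst i j.
  have [//|v vP] := @end_dominator S (Ordinal n_gt0) (Ordinal lt1n) sSE isT isT.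
  rewrite -addn1 addnC -(cards1 v).
  apply: (@layout_domination S [set v] (fun j => 3 * j.+1 - 1)) => // [j' lj'|x].
    by apply: (@third (3 * 0) (3 * 0 + 1)) => //; lia.
  have [x0|x_gt0] := posnP x.2.
    by right; exists v; rewrite ?inE //; apply: vP; apply: val_inj.
  by left; exists ((x.2 - 1) %/ 3); rewrite /near; have := ltn_ord x.2; lia.
have [i ji bi] := badN j_gt0.
have jk : j = k.
  apply/eqP; rewrite eqn_leq -ltnS ltj leqNgt; apply/negP => ltjk.
  have [i' ji' bi'] := bad1 ltjk.
  suff : good S (3 * i' + 1) by apply/negP.
  by apply: (@third (3 * j) (3 * i - 1)) => //; lia.
(* The last two layers are bad: layers 1, 4, ... and one vertex for the last. *)
subst j; have ik : i = k by lia.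
subst i.
have lt0 : 3 * k < n by lia.
have lt1 : 3 * k - 1 < n by lia.
have [|||v vP] := @end_dominator S (Ordinal lt0) (Ordinal lt1) sSE.
- by rewrite -val_eqE /=; lia.
- by rewrite /near /=; lia.
- by [].

rewrite -addn1 addnC -(cards1 v).
apply: (@layout_domination S [set v] (fun j => 3 * j + 1)) => // [j' lj'|x].
  by apply: (@third (3 * k) (3 * k - 1)) => //; lia.
have [xk|x_lt] := eqVneq (nat_of_ord x.2) (3 * k).
  by right; exists v; rewrite ?inE //; apply: vP; apply: val_inj.
by left; exists (x.2 %/ 3); rewrite /near; have := ltn_ord x.2; lia.
Qed.

(* The arithmetic of layers never depends on the hypotheses about sets. *)
Local Ltac layer_lia :=
  repeat match goal with
  | H : is_true (_ \in _) |- _ => clear H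
  | H : is_true (_ \subset _) |- _ => clear H
  | H : is_true (~~ _) |- _ => clear H
  | H : is_true (dominating _ _) |- _ => clear H
  | H : _ -> _ |- _ => clear H
  | H : forall _, _ |- _ => clear H
  end; lia.

(** * Deletions that raise the domination number *)

Lemma matching_layers (l l' : 'I_n) : l != l' -> near l l' ->
  exists S, [/\ S \subset edges G, #|S| <= m,
    forall v, v.2 = l -> exists2 x : V, x.2 = l' & [set x; v] \in S &
    forall v, v.2 = l' -> exists2 x : V, x.2 = l & [set x; v] \in S].
Proof.
move=> nll' near_ll'.
pose S := [set [set (i, l); (i, l')] | i : 'I_m]; exists S; split.
- apply/subsetP => _ /imsetP[i _ ->]; apply: edges_mem.
  by rewrite product_adjE near_ll' andbT xpair_eqE (negPf nll') andbF.
- by apply: leq_trans (leq_imset_card _ _) _; rewrite card_ord.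
- case=> i a /= ->; exists (i, l') => //.
  by rewrite setUC; apply: imset_f.
- by case=> i a /= ->; exists (i, l) => //; apply: imset_f.
Qed.

(** Consecutive vertices of layer [l] are paired; for odd [m] the last one is
    left alone and is joined to layer [l'] instead. *)
Lemma halving_layer (l l' : 'I_n) : l != l' -> near l l' ->
  exists S, [/\ S \subset edges G, #|S| <= uphalf m &
    forall v, v.2 = l -> exists2 x : V, x != v /\ x.2 \in [:: l; l'] & [set x; v] \in S].
Proof.
move=> nll' near_ll'.
pose c (i : nat) : 'I_m := insubd i0 i.
have cE i : i < m -> val (c i) = i by move=> lti; rewrite val_insubd lti.
pose mate i : V := if 2 * i + 1 < m then (c (2 * i + 1), l) else (c (2 * i), l').
pose S := [set [set (c (2 * i), l); mate i] | i : 'I_(uphalf m)].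
have mate_neq (i : 'I_(uphalf m)) : (c (2 * i), l) != mate i.
  rewrite /mate; case: ifP => lt; rewrite xpair_eqE ?(negPf nll') ?andbF // eqxx andbT.
  by rewrite -val_eqE /= !cE; lia.
exists S; split.
- apply/subsetP => _ /imsetP[i _ ->]; apply: edges_mem.
  rewrite product_adjE mate_neq /mate; case: ifP => _ //=; rewrite /near; lia.
- by apply: leq_trans (leq_imset_card _ _) _; rewrite card_ord.
case=> a b /= ->; have lth : a./2 < uphalf m by have := ltn_ord a; lia.
pose h := Ordinal lth.
have hS : [set (c (2 * h), l); mate h] \in S by apply: imset_f.
have := odd_double_half a; case: (boolP (odd a)) => odda aE.
  have ca : c (2 * h + 1) = a by apply: val_inj; rewrite /= cE /=; have := ltn_ord a; lia.
  have mh : mate h = (a, l).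
    by rewrite /mate ca ifT //=; have := ltn_ord a; lia.
  exists (c (2 * h), l); rewrite -?mh //; split=> //.
  by rewrite inE eqxx.
have ca : c (2 * h) = a by apply: val_inj; rewrite /= cE /=; have := ltn_ord a; lia.
exists (mate h); last by rewrite setUC -ca.
by rewrite -{1}ca eq_sym mate_neq /mate; case: ifP => _; rewrite !inE eqxx ?orbT.
Qed.

(** A vertex that lost the edge to [x] leaves [x] to another dominator. *)
Lemma other_dominator S D x d :
    dominating (del_edges G S) D -> x != d -> [set x; d] \in S ->
  exists d' : V, [/\ d' \in D, d' != d & near x.2 d'.2].
Proof.
move=> /dominatingP domD nxd xdS; have [d' d'D xd'] := domD x; exists d'.
split=> //.
  apply/eqP => e; subst d'; case: xd' => [e|/andP[_]]; last by rewrite xdS.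
  by rewrite e eqxx in nxd.
by case: xd' => [->|/del_near //]; rewrite /near; lia.
Qed.

Lemma layer_dominator S D (l : 'I_n) :
    dominating (del_edges G S) D -> exists2 d : V, d \in D & near l d.2.
Proof.
move=> /dominatingP/(_ (i0, l))[d dD xd]; exists d => //.
by case: xd => [<-|/del_near //]; rewrite /near /=; lia.
Qed.

Lemma neq_layer x v : x.2 != v.2 -> x != v.
Proof. by apply: contraNneq => ->. Qed.

(** The dominator [d] of layer 0 is not in that layer, for then layers
    [2, 5, ...] would need [k] further vertices. In layer 1 it misses some [x]
    in layer 0 or 1, and the second dominator required by [x] is still too low
    to serve layers [4, 7, ...]. *)
Lemma many_deletions_mod0 k : 0 < k -> n = 3 * k ->
  exists2 S : {set {set V}}, S \subset edges G /\ #|S| <= uphalf m &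
    k < domination_number (del_edges G S).
Proof.
move=> k_gt0 nE.
have lt0 : 0 < n by layer_lia.
have lt1 : 1 < n by layer_lia.
have [//|//|S [sSE leS halfS]] := @halving_layer (Ordinal lt1) (Ordinal lt0).
exists S => //; apply: domination_number_gt => D domD leD.
have pack := packing (@del_near S) domD.
have [d dD] := layer_dominator (Ordinal lt0) domD; rewrite /near /= => nd.
have d1 : nat_of_ord d.2 = 1.
  have [d0|] := posnP d.2; last layer_lia.
  suff : 1 + k <= #|D| by layer_lia.
  apply: (pack [:: d] 2) => // [v|j]; last layer_lia.
  by rewrite inE => /eqP->; rewrite d0.
have [|x [nxd xl] xdS] := halfS d; first exact: val_inj.
have [d' [d'D nd' nx]] := other_dominator domD nxd xdS.
have {xl}xl : x.2 < 2 by move: xl; rewrite !inE -!val_eqE /=; layer_lia.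
suff : 2 + (k - 1) <= #|D| by layer_lia.
apply: (pack [:: d; d'] 4) => [|v|j]; last layer_lia.
  by rewrite /= inE eq_sym nd'.
by rewrite !inE => /orP[]/eqP->; split=> //; move: nx; rewrite /near; layer_lia.
Qed.

(** The dominator of layer 0 misses its partner in the matching; the two
    vertices that dominate layers 0 and 1 are too low for layers
    [4, 7, ..., 3k + 1]. *)
Lemma many_deletions_mod2 k : n = 3 * k + 2 ->
  exists2 S : {set {set V}}, S \subset edges G /\ #|S| <= m &
    k.+1 < domination_number (del_edges G S).
Proof.
move=> nE.
have lt0 : 0 < n by layer_lia.
have lt1 : 1 < n by layer_lia.
have [//|//|S [sSE leS M0 M1]] := @matching_layers (Ordinal lt0) (Ordinal lt1).
exists S => //; apply: domination_number_gt => D domD leD.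
have pack := packing (@del_near S) domD.
have [d dD] := layer_dominator (Ordinal lt0) domD; rewrite /near /= => nd.
have [x [nxd xl xdS]] : exists x : V, [/\ x != d, x.2 < 2 & [set x; d] \in S].
  have [d0|d_gt0] := posnP d.2.
    have [|x xl xdS] := M0 d; first exact: val_inj.
    by exists x; split=> //; rewrite ?xl //; apply: neq_layer; rewrite xl -val_eqE /= d0.
  have d1 : nat_of_ord d.2 = 1 by layer_lia.
  have [|x xl xdS] := M1 d; first exact: val_inj.
  by exists x; split=> //; rewrite ?xl //; apply: neq_layer; rewrite xl -val_eqE /= d1.
have [d' [d'D nd' nx]] := other_dominator domD nxd xdS.
suff : 2 + k <= #|D| by layer_lia.
apply: (pack [:: d; d'] 4) => [|v|j]; last layer_lia.
  by rewrite /= inE eq_sym nd'.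
by rewrite !inE => /orP[]/eqP->; split=> //; move: nx; rewrite /near; layer_lia.
Qed.

(** Only one dominator [d] fits in layers 0 and 1, as layers [3, 6, ...] need
    [k] others. It lies in layer 0, since in layer 1 its partner would be left
    undominated. Its partner [x] in layer 1 then needs a dominator [d2] in layer
    2, which in turn misses some [y] in layer 2 or 3; the dominator [d3] of [y]
    is still too low to serve layers [6, 9, ...]. *)
Lemma many_deletions_mod1 k : 0 < k -> n = 3 * k + 1 ->
  exists2 S : {set {set V}}, S \subset edges G /\ #|S| <= uphalf (3 * m) &
    k.+1 < domination_number (del_edges G S).
Proof.
move=> k_gt0 nE.
have lt0 : 0 < n by layer_lia.
have lt1 : 1 < n by layer_lia.
have lt2 : 2 < n by layer_lia.
have lt3 : 3 < n by layer_lia.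
have [//|//|S01 [sSE01 leS01 M0 M1]] := @matching_layers (Ordinal lt0) (Ordinal lt1).
have [//|//|S2 [sSE2 leS2 half2]] := @halving_layer (Ordinal lt2) (Ordinal lt3).
pose S := S01 :|: S2; exists S.
  split; first by rewrite subUset sSE01.
  by apply: leq_trans (leq_card_setU _ _) _; layer_lia.
apply: domination_number_gt => D domD leD.
have pack := packing (@del_near S) domD.
have [d dD] := layer_dominator (Ordinal lt0) domD; rewrite /near /= => nd.
have unique d' : d' \in D -> d' != d -> 1 < d'.2.
  move=> d'D nd'; rewrite ltnNge; apply/negP => ld'.
  suff : 2 + k <= #|D| by layer_lia.
  apply: (pack [:: d; d'] 3) => [|v|j]; last layer_lia.
    by rewrite /= inE eq_sym nd'.
  by rewrite !inE => /orP[]/eqP->; split=> //; layer_lia.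
have d0 : nat_of_ord d.2 = 0.
  have [//|d_gt0] := posnP d.2; exfalso.
  have d1 : nat_of_ord d.2 = 1 by layer_lia.
  have [|x xl xdS] := M1 d; first exact: val_inj.
  have [||d' [d'D nd' nx]] := @other_dominator S D x d domD.
  - by apply: neq_layer; rewrite xl -val_eqE /= d1.
  - by rewrite inE xdS.
  by have := unique d' d'D nd'; move: nx; rewrite /near xl /=; layer_lia.
have [|x xl xdS] := M0 d; first exact: val_inj.
have [||d2 [d2D nd2 nx]] := @other_dominator S D x d domD.
- by apply: neq_layer; rewrite xl -val_eqE /= d0.
- by rewrite inE xdS.
have l2 : nat_of_ord d2.2 = 2.
  by have := unique d2 d2D nd2; move: nx; rewrite /near xl /=; layer_lia.
have [|y [nyd2 yl] ydS] := half2 d2; first exact: val_inj.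
have [|d3 [d3D nd3 ny]] := @other_dominator S D y d2 domD nyd2.
  by rewrite inE ydS orbT.
have {yl}yl : 2 <= y.2 <= 3 by move: yl; rewrite !inE -!val_eqE /=; layer_lia.
suff : 3 + (k - 1) <= #|D| by layer_lia.
apply: (pack [:: d; d2; d3] 6) => [|v|j]; last layer_lia.
  rewrite /= !inE eq_sym negb_or nd2 (eq_sym d2) nd3 !andbT /=.
  by apply: neq_layer; rewrite -val_eqE /= d0; move: ny; rewrite /near; layer_lia.
by rewrite !inE => /or3P[]/eqP->; split=> //; move: ny; rewrite /near; layer_lia.
Qed.

(** The case of no deletion in the last hypothesis bounds the domination number
    of the product itself from above. *)
Lemma product_bondageE K b :
    (n + 2) %/ 3 = K ->
    (exists2 S : {set {set V}}, S \subset edges G /\ #|S| <= b &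
       K < domination_number (del_edges G S)) ->
    0 < b ->
    (forall S, S \subset edges G -> #|S| < b ->
       domination_number (del_edges G S) <= K) ->
  bondage_number G = b.
Proof.
move=> KE [S [sSE leS] gtS] b_gt0 few.
have geK : K <= domination_number G by rewrite -KE product_domination_ge.
have leK : domination_number G <= K.
  apply: leq_trans (domination_number_del G set0) _.
  by apply: few; rewrite ?sub0set ?cards0.
apply: (bondage_numberE (S := S)) => //.
  by rewrite /bondage_set sSE (leq_ltn_trans leK).
by move=> S' sS'E ltS'; apply: leq_trans geK; apply: few.
Qed.

End Layers.

(* uphalf k is the ceiling of k / 2 *)
Theorem theorem3p19 (m n : nat) (hm : 1 <= m) (hn : 2 <= n) :
  bondage_number (strong_product (complete_graph m) (path_graph n)) =
    if n %% 3 == 0 then uphalf m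
    else if n %% 3 == 2 then m
    else uphalf (3 * m).
Proof.
case: eqP => [r0|nr0].
  have nE : n = 3 * (n %/ 3) by lia.
  apply: (@product_bondageE m n hm (n %/ 3)); [lia | | lia |].
    by apply: many_deletions_mod0 => //; lia.
  by move=> S sSE ltS; apply: few_deletions_mod0 => //; lia.
case: eqP => [r2|nr2].
  have nE : n = 3 * (n %/ 3) + 2 by lia.
  apply: (@product_bondageE m n hm (n %/ 3).+1) => //; first lia.
    exact: many_deletions_mod2.
  by move=> S sSE ltS; apply: few_deletions_mod2.
have nE : n = 3 * (n %/ 3) + 1 by lia.
apply: (@product_bondageE m n hm (n %/ 3).+1); [lia | | lia |].
  by apply: many_deletions_mod1 => //; lia.
by move=> S sSE ltS; apply: few_deletions_mod1 => //; lia.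
Qed.
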